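(* Let $T$ be a positive theory with the joint embedding property in a single-sorted signature $L$ with monster model $\mathfrak M$, and let $\mathcal E$ be a set of partial types as described in the context. Then the $L_{\mathcal E}$-structure $\mathfrak M^{\mathcal E}$ is a monster model of the $L_{\mathcal E}$-theory $T^{\mathcal E}$, i.e. it is an existentially closed model of $T^{\mathcal E}$ which is very saturated and very homogeneous (with the same degree of saturation and homogeneity as $\mathfrak M$).
   Context: Positive logic: ''formula'' means positive existential formula (built from atomic formulas using $\wedge,\vee,\top,\bot,\exists$); a theory is a set of h-inductive sentences $\forall x(\varphi(x)\to\psi(x))$ with $\varphi,\psi$ positive existential. A model $M$ of $T$ is existentially closed (e.c.) if every homomorphism (map preserving formulas) from $M$ into a model of $T$ also reflects formulas. A monster model is an e.c. model that is very saturated (every finitely satisfiable small set of formulas over it is realised) and very homogeneous (every partial map with small domain and codomain preserving and reflecting formulas extends to an automorphism). Hyperimaginary extension: let $\mathcal E$ be a set of partial types $E(x,y)$ over $\emptyset$ ($x,y$ small tuples of the same length) each defining an equivalence relation on tuples of $\mathfrak M$. $L_{\mathcal E}$ is the multi-sorted signature with the real sort (carrying $L$) and a sort $S_E$ for each $E\in\mathcal E$, and for all $E_1,\dots,E_n\in\mathcal E$ and each $L$-formula $\varphi(x,y_1,\dots,y_n)$ (with $y_j$ a real tuple matching $E_j$) a relation symbol $R_\varphi(x,z_1,\dots,z_n)$ with $z_j$ of sort $S_{E_j}$. $\mathfrak M^{\mathcal E}$ has real sort $\mathfrak M$, sort $S_E$ equal to the set of $E$-classes of tuples of $\mathfrak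 M$, and $R_\varphi(a,c_1,\dots,c_n)$ holds iff there are representatives $b_j$ of $c_j$ with $\mathfrak M\models\varphi(a,b_1,\dots,b_n)$. $T^{\mathcal E}$ is the set of all h-inductive $L_{\mathcal E}$-sentences true in $\mathfrak M^{\mathcal E}$. *)

(* Defs.v *)
From HB Require Import structures.
From mathcomp Require Import all_boot.
From mathcomp Require Import boolp classical_sets functions cardinality.
From Corelib Require Import RelationClasses.

Set Implicit Arguments.
Unset Strict Implicit.
Unset Printing Implicit Defensive.

Local Open Scope classical_set_scope.
Local Open Scope card_scope.

Record signature := Signature {
  sorts : Type;
  fsym : Type;
  farity : fsym -> finType;
  fdom : forall f, farity f -> sorts;
  fcod : fsym -> sorts;
  rsym : Type;
  rarity : rsym -> finType;
  rdom : forall r, rarity r -> sorts }.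
Arguments fdom {s} f _.
Arguments rdom {s} r _.

(* A context is a type V of variables, of any cardinality, together with the
   sort of each variable; a tuple of elements of M matching the context is a
   function [forall v, M (srt v)]. A formula mentions only finitely many of the
   variables of its context. *)
Inductive term (L : signature) (V : Type) (srt : V -> sorts L) :
    sorts L -> Type :=
| Var (v : V) : term srt (srt v)
| App (f : fsym L) (t : forall i, term srt (fdom f i)) : term srt (fcod f).

Definition ext_srt (L : signature) (V : Type) (srt : V -> sorts L) (s : sorts L)
    (o : option V) : sorts L :=
  if o is Some v then srt v else s.

Inductive form (L : signature) (V : Type) (srt : V -> sorts L) : Type :=
| Rel (r : rsym L) (t : forall i, term srt (rdom r i))
| Eq (s : sorts L) (t u : term srt s)
| Top
| Bot
| And (p q : form srt)
| Or (p q : form srt)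
| Ex (s : sorts L) (p : form (ext_srt srt s)).

Record structure (L : signature) := Structure {
  carrier :> sorts L -> Type;
  finterp : forall f, (forall i, carrier (fdom f i)) -> carrier (fcod f);
  rinterp : forall r, (forall i, carrier (rdom r i)) -> Prop }.

Fixpoint eval (L : signature) (M : structure L) (V : Type) (srt : V -> sorts L)
    (a : forall v, M (srt v)) (s : sorts L) (t : term srt s) : M s :=
  match t with
  | Var v => a v
  | App f ts => finterp (fun i => eval a (ts i))
  end.

Definition ext_asg (L : signature) (M : structure L) (V : Type)
    (srt : V -> sorts L) (a : forall v, M (srt v)) (s : sorts L) (x : M s)
    (o : option V) : M (ext_srt srt s o) :=
  match o with Some v => a v | None => x end.

Fixpoint sat (L : signature) (M : structure L) (V : Type) (srt : V -> sorts L)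
    (p : form srt) : (forall v, M (srt v)) -> Prop :=
  match p with
  | Rel r t => fun a => rinterp (fun i => eval a (t i))
  | Eq _ t u => fun a => eval a t = eval a u
  | Top => fun=> True
  | Bot => fun=> False
  | And p q => fun a => sat p a /\ sat q a
  | Or p q => fun a => sat p a \/ sat q a
  | Ex s p => fun a => exists x : M s, sat p (ext_asg a x)
  end.

Record hsentence (L : signature) := HSentence {
  hvars : nat;
  hsrt : 'I_hvars -> sorts L;
  hyp : form hsrt;
  concl : form hsrt }.

Arguments hsrt {L} h _.

Definition theory (L : signature) := set (hsentence L).

Definition htrue (L : signature) (M : structure L) (c : hsentence L) : Prop :=
  forall a : forall i, M (hsrt c i), sat (hyp c) a -> sat (concl c) a.

Definition is_model (L : signature) (T : theory L) (M : structure L) : Prop :=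
  T `<=` htrue M.

Definition theory_of (L : signature) (M : structure L) : theory L :=
  [set c | htrue M c].

Definition preserves (L : signature) (M N : structure L)
    (h : forall s, M s -> N s) : Prop :=
  forall (V : Type) (srt : V -> sorts L) (p : form srt)
    (a : forall v, M (srt v)), sat p a -> sat p (fun v => h (srt v) (a v)).

Definition reflects (L : signature) (M N : structure L)
    (h : forall s, M s -> N s) : Prop :=
  forall (V : Type) (srt : V -> sorts L) (p : form srt)
    (a : forall v, M (srt v)), sat p (fun v => h (srt v) (a v)) -> sat p a.

Definition homomorphism (L : signature) (M N : structure L)
    (h : forall s, M s -> N s) : Prop := preserves h.

Definition automorphism (L : signature) (M : structure L)
    (g : forall s, M s -> M s) : Prop :=
  [/\ forall s, bijective (g s), preserves g & reflects g].

Definition existentially_closed (L : signature) (T : theory L)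
    (M : structure L) : Prop :=
  is_model T M /\
  forall (N : structure L) (h : forall s, M s -> N s),
    is_model T N -> homomorphism h -> reflects h.

Definition joint_embedding (L : signature) (T : theory L) : Prop :=
  forall M1 M2 : structure L, is_model T M1 -> is_model T M2 ->
  exists (N : structure L) (h1 : forall s, M1 s -> N s)
    (h2 : forall s, M2 s -> N s),
    [/\ is_model T N, homomorphism h1 & homomorphism h2].

(* The degree kappa of saturation and homogeneity is the cardinality of a type
   K, and A is small when |A| < kappa. *)
Definition small (K : Type) (U : Type) (A : set U) : Prop :=
  A #<= [set: K] /\ ~ ([set: K] #<= A).

Definition uncountable_regular (K : Type) : Prop :=
  small K [set: nat] /\
  forall (J : Type) (A : J -> Type), small K [set: J] ->
    (forall j, small K [set: A j]) -> small K [set: {j : J & A j}].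

Definition small_signature (K : Type) (L : signature) : Prop :=
  [/\ small K [set: sorts L], small K [set: fsym L] & small K [set: rsym L]].

(* Formulas over M in the variables V: every element of M is available as an
   additional variable, which always denotes itself. *)
Definition par_srt (L : signature) (M : structure L) (V : Type)
    (srt : V -> sorts L) (w : V + {s : sorts L & M s}) : sorts L :=
  match w with inl v => srt v | inr m => projT1 m end.

Definition par_asg (L : signature) (M : structure L) (V : Type)
    (srt : V -> sorts L) (a : forall v, M (srt v))
    (w : V + {s : sorts L & M s}) : M (par_srt srt w) :=
  match w with inl v => a v | inr m => projT2 m end.

Definition very_saturated (K : Type) (L : signature) (M : structure L) : Prop :=
  forall (V : Type) (srt : V -> sorts L) (Sigma : set (form (@par_srt L M V srt))),
    small K [set: V] -> small K Sigma ->
    (forall F : set (form (@par_srt L M V srt)), finite_set F -> F `<=` Sigma ->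
       exists a : forall v, M (srt v), forall p, F p -> sat p (par_asg a)) ->
    exists a : forall v, M (srt v), forall p, Sigma p -> sat p (par_asg a).

(* A partial map of M with domain D is a total map f of which only the values on
   D matter; its codomain f(D) is small as soon as D is. *)
Definition very_homogeneous (K : Type) (L : signature) (M : structure L) : Prop :=
  forall (D : set {s : sorts L & M s}) (f : forall s, M s -> M s),
    small K D ->
    (forall (V : Type) (srt : V -> sorts L) (p : form srt)
       (a : forall v, M (srt v)),
       (forall v, D (existT _ (srt v) (a v))) ->
       (sat p a <-> sat p (fun v => f (srt v) (a v)))) ->
    exists2 g : forall s, M s -> M s, automorphism g &
      forall s (x : M s), D (existT _ s x) -> g s x = f s x.

Definition monster (K : Type) (L : signature) (T : theory L)
    (M : structure L) : Prop :=
  [/\ existentially_closed T M, very_saturated K M & very_homogeneous K M].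

Record signature1 := Signature1 {
  fsym1 : Type;
  farity1 : fsym1 -> nat;
  rsym1 : Type;
  rarity1 : rsym1 -> nat }.

Definition single_sorted (L : signature1) : signature :=
  @Signature unit (fsym1 L) (fun f => 'I_(farity1 f)) (fun _ _ => tt)
    (fun=> tt) (rsym1 L) (fun r => 'I_(rarity1 r)) (fun _ _ => tt).
Coercion single_sorted : signature1 >-> signature.

Definition form1 (L : signature1) (V : Type) : Type :=
  @form (single_sorted L) V (fun=> tt).

(* A family, indexed by the type [ptindex], of partial types E(x, y) without
   parameters, where x and y are tuples indexed by [ptlen E]; the left and right
   summands of [ptlen E + ptlen E] are the variables of x and of y. *)
Record ptype_family (L : signature1) := PtypeFamily {
  ptindex :> Type;
  ptlen : ptindex -> Type;
  ptype : forall E : ptindex, set (form1 L (ptlen E + ptlen E)) }.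
Arguments ptlen {L p} E.
Arguments ptype {L p} E _.

Section Hyperimaginaries.
Variables (L : signature1) (EE : ptype_family L) (M : structure L).

Definition ptrel (E : EE) (b c : ptlen E -> M tt) : Prop :=
  forall p, ptype E p ->
    sat p (fun w => match w with inl i => b i | inr i => c i end).

Definition defines_equivalences : Prop :=
  forall E : EE, Equivalence (@ptrel E).

(* The relation symbols R_phi: phi has finitely many real variables x (indexed
   by 'I_hx) and, for each j : 'I_hn, a real tuple y_j matching hE j. *)
Record hrsym := HRsym {
  hx : nat;
  hn : nat;
  hE : 'I_hn -> EE;
  hphi : form1 L ('I_hx + {j : 'I_hn & ptlen (hE j)}) }.

(* None is the real sort, Some E the sort S_E. *)
Definition hyper_rarity (r : rsym L + hrsym) : finType :=
  match r with
  | inl r => rarity r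
  | inr R => ('I_(hx R) + 'I_(hn R))%type
  end.

Definition hyper_rdom (r : rsym L + hrsym) : hyper_rarity r -> option EE :=
  match r with
  | inl r => fun=> None
  | inr R => fun i => match i with inl _ => None | inr j => Some (hE j) end
  end.

Definition hyper_sig : signature :=
  @Signature (option EE) (fsym L) (@farity L) (fun _ _ => None) (fun=> None)
    (rsym L + hrsym) hyper_rarity hyper_rdom.

(* The E-classes, as subsets of the set of tuples. *)
Definition hyper_class (E : EE) : Type :=
  {C : set (ptlen E -> M tt) | exists b, C = [set c | ptrel b c]}.

Definition hyper_carrier (s : sorts hyper_sig) : Type :=
  match s with None => M tt | Some E => hyper_class E end.

Definition hyper_finterp (f : fsym hyper_sig)
    (a : forall i, hyper_carrier (fdom f i)) : hyper_carrier (fcod f) :=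
  @finterp L M f a.

Definition hyper_rinterp (r : rsym hyper_sig) :
    (forall i, hyper_carrier (rdom r i)) -> Prop :=
  match r with
  | inl r => fun a => @rinterp L M r a
  | inr R => fun a =>
      exists b : forall j : 'I_(hn R), ptlen (hE j) -> M tt,
        (forall j, sval (a (inr j)) (b j)) /\
        sat (hphi R) (fun w => match w with
                               | inl i => a (inl i)
                               | inr jk => b (projT1 jk) (projT2 jk)
                               end)
  end.

Definition hyper_struct : structure hyper_sig :=
  @Structure hyper_sig hyper_carrier hyper_finterp hyper_rinterp.

Definition hyper_theory : theory hyper_sig := theory_of hyper_struct.

End Hyperimaginaries.

Arguments defines_equivalences {L} EE M.
Arguments hyper_sig {L} EE.
Arguments hyper_struct {L} EE M.
Arguments hyper_theory {L} EE M.

(* Main.v *)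
(* Write [b] for a class with representative b.  By saturation of M, every
   L_E-formula p(x, [y]) is equivalent to a small set of L-formulas in (x, y),
   and conversely every L-formula phi(x, y) yields the relation R_phi(x, [y]).

   Existential closedness: if M^E does not satisfy p(a, [b]), some L-formula
   implied by p fails at (a, b).  As M is existentially closed, another
   L-formula phi holds at (a, b) and contradicts it, so that R_phi holds at
   (a, [b]) and contradicts p modulo T^E.  Homomorphisms into models of T^E
   therefore reflect p.

   Saturation: replace each formula by its set of L-formulas and realise these
   in M by representatives.

   Homogeneity: given a partial map f between small sets of classes and
   representatives b of its domain, saturation gives representatives b' of the
   images with the same L-type as b; an automorphism of M taking b to b' induces
   one of M^E extending f. *)
Require Import Defs.
From Stdlib Require List.
From mathcomp Require Import all_boot.
From mathcomp Require Import boolp classical_sets functions cardinality filter.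

Set Implicit Arguments.
Unset Strict Implicit.
Unset Printing Implicit Defensive.

Local Open Scope classical_set_scope.

(** * Substitution in terms and formulas *)

Lemma in_enum (I : finType) (i : I) : List.In i (enum I).
Proof.
have := mem_enum I i; elim: (enum I) => //= j s IH.
by rewrite in_cons => /orP[/eqP->|/IH]; [left|right].
Qed.

Lemma in_tnth (X : Type) (x : X) (l : list X) :
  List.In x l -> exists i, tnth (in_tuple l) i = x.
Proof.
elim: l => //= w m IH [->|/IH [i <-]].
  by exists (Ordinal (ltn0Sn _)).
by exists (lift ord0 i); rewrite !(tnth_nth w).
Qed.

(** Since [sub] takes a proof of membership in [l], replacements are required only for the finitely
    many variables that occur in [t]. The term [t'] is chosen before the structure, so it serves all
    structures at once. *)
Lemma term_psubst (L : signature) (V : Type) (srt : V -> sorts L) (s : sorts L)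
    (t : term srt s) :
  exists l : list V, forall (V' : Type) (srt' : V' -> sorts L)
    (sub : forall v, List.In v l -> term srt' (srt v)),
  exists t' : term srt' s, forall (M : structure L) (a : forall v, M (srt v))
    (a' : forall v, M (srt' v)),
    (forall v (vl : List.In v l), a v = eval a' (sub v vl)) ->
    eval a t = eval a' t'.
Proof.
elim: t => [v|f ts IH].
  exists [:: v] => V' srt' sub; exists (sub v (or_introl erefl)) => M a a' aE.
  exact: aE.
pose l i := sval (cid (IH i)); have lP i := svalP (cid (IH i)).
rewrite -/(l _) in lP.
have lsub i v :
    List.In v (l i) -> List.In v (List.flat_map l (enum (farity f))).
  by move=> vi; apply/List.in_flat_map; exists i; split=> //; exact: in_enum.
exists (List.flat_map l (enum (farity f))) => V' srt' sub.
have tP i := svalP (cid (lP i V' srt' (fun v vl => sub v (lsub i v vl)))).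
set t' := fun i => sval (cid (lP i V' srt' (fun v vl => sub v (lsub i v vl)))).
exists (App t') => M a a' aE /=; congr finterp.
apply: functional_extensionality_dep => i; apply: tP => v vl; exact: aE.
Qed.

Lemma term_subst (L : signature) (V V' : Type) (srt : V -> sorts L)
    (srt' : V' -> sorts L) (sub : forall v, term srt' (srt v)) s
    (t : term srt s) :
  {t' : term srt' s | forall (M : structure L) (a : forall v, M (srt' v)),
    eval a t' = eval (fun v => eval a (sub v)) t}.
Proof.
apply: cid; have [l lP] := term_psubst t.
have [t' t'P] := lP V' srt' (fun v _ => sub v).
by exists t' => M a; rewrite (t'P M (fun v => eval a (sub v)) a).
Qed.

Lemma term_weaken (L : signature) (V : Type) (srt : V -> sorts L)
    (s s' : sorts L) (t : term srt s) :
  {t' : term (ext_srt srt s') s | forall (M : structure L)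
    (a : forall v, M (srt v)) (x : M s'), eval (ext_asg a x) t' = eval a t}.
Proof.
have [t' t'P] := term_subst (fun v => @Var L _ (ext_srt srt s') (Some v)) t.
by exists t' => M a x; rewrite t'P.
Qed.

(* The list [l] contains the variables occurring in [p]; a substitution need
   only be given on [l]. *)
Lemma form_psubst (L : signature) (V : Type) (srt : V -> sorts L)
    (p : form srt) :
  exists l : list V, forall (V' : Type) (srt' : V' -> sorts L)
    (sub : forall v, List.In v l -> term srt' (srt v)),
  exists p' : form srt', forall (M : structure L) (a : forall v, M (srt v))
    (a' : forall v, M (srt' v)),
    (forall v (vl : List.In v l), a v = eval a' (sub v vl)) ->
    (sat p a <-> sat p' a').
Proof.
elim: p => {V srt}
  [V srt r ts|V srt s t u|V srt|V srt|V srt p IHp q IHq|V srt p IHp q IHq|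
   V srt s p IH].
- pose l i := sval (cid (term_psubst (ts i))).
  have lP i := svalP (cid (term_psubst (ts i))).
  rewrite -/(l _) in lP.
  have lsub i v :
      List.In v (l i) -> List.In v (List.flat_map l (enum (rarity r))).
    by move=> vi; apply/List.in_flat_map; exists i; split=> //;
      apply: in_enum.
  exists (List.flat_map l (enum (rarity r))) => V' srt' sub.
  have tP i := svalP (cid (lP i V' srt' (fun v vl => sub v (lsub i v vl)))).
  set t' := fun i =>
    sval (cid (lP i V' srt' (fun v vl => sub v (lsub i v vl)))).
  exists (Rel t') => M a a' aE /=.
  suff -> : (fun i => eval a (ts i)) = (fun i => eval a' (t' i)) by [].
  apply: functional_extensionality_dep => i; apply: tP => v vl; exact: aE.
- have [lt ltP] := term_psubst t; have [lu luP] := term_psubst u.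
  exists (lt ++ lu)%list => V' srt' sub.
  have [t' t'P] := ltP V' srt'
    (fun v vl => sub v (proj2 (List.in_app_iff _ _ _) (or_introl vl))).
  have [u' u'P] := luP V' srt'
    (fun v vl => sub v (proj2 (List.in_app_iff _ _ _) (or_intror vl))).
  exists (Eq t' u') => M a a' aE /=.
  by rewrite (t'P M a a') ?(u'P M a a').
- by exists nil => V' srt' sub; exists (Top _).
- by exists nil => V' srt' sub; exists (Bot _).
- have [lt ltP] := IHp; have [lu luP] := IHq.
  exists (lt ++ lu)%list => V' srt' sub.
  have [t' t'P] := ltP V' srt'
    (fun v vl => sub v (proj2 (List.in_app_iff _ _ _) (or_introl vl))).
  have [u' u'P] := luP V' srt'
    (fun v vl => sub v (proj2 (List.in_app_iff _ _ _) (or_intror vl))).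
  exists (And t' u') => M a a' aE /=.
  by rewrite (t'P M a a') ?(u'P M a a').
- have [lt ltP] := IHp; have [lu luP] := IHq.
  exists (lt ++ lu)%list => V' srt' sub.
  have [t' t'P] := ltP V' srt'
    (fun v vl => sub v (proj2 (List.in_app_iff _ _ _) (or_introl vl))).
  have [u' u'P] := luP V' srt'
    (fun v vl => sub v (proj2 (List.in_app_iff _ _ _) (or_intror vl))).
  exists (Or t' u') => M a a' aE /=.
  by rewrite (t'P M a a') ?(u'P M a a').
- have [l lP] := IH.
  pose g (o : option V) := if o is Some v then [:: v] else [::].
  have lsub v : List.In (Some v) l -> List.In v (List.flat_map g l).
    by move=> vl; apply/List.in_flat_map; exists (Some v); split=> //; left.
  exists (List.flat_map g l) => V' srt' sub.
  (* Under the quantifier the bound variable is kept, and the substituted terms are weakened so as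
     not to depend on it. *)
  have [p' p'P] := lP (option V') (ext_srt srt' s)
    (fun o => match o return List.In o l ->
                             term (ext_srt srt' s) (ext_srt srt s o) with
     | Some v => fun vl => sval (term_weaken s (sub v (lsub v vl)))
     | None => fun _ => @Var L _ (ext_srt srt' s) None
     end).
  exists (Ex p') => M a a' aE /=.
  have E x : sat p (ext_asg a x) <-> sat p' (ext_asg a' x).
    apply: p'P => -[v|] vl //=.
    by rewrite (svalP (term_weaken s (sub v (lsub v vl)))) -aE.
  by split=> -[x px]; exists x; apply/E.
Qed.

Lemma form_subst (L : signature) (V V' : Type) (srt : V -> sorts L)
    (srt' : V' -> sorts L) (sub : forall v, term srt' (srt v)) (p : form srt) :
  {p' : form srt' | forall (M : structure L) (a : forall v, M (srt' v)),
    sat p' a <-> sat p (fun v => eval a (sub v))}.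
Proof.
apply: cid; have [l lP] := form_psubst p.
have [p' p'P] := lP V' srt' (fun v _ => sub v).
by exists p' => M a; rewrite (p'P M (fun v => eval a (sub v)) a).
Qed.

(** Under the identity substitution, [sat p a] and [sat p a'] are both equivalent to [sat p' a']. *)
Lemma form_support (L : signature) (V : Type) (srt : V -> sorts L)
    (p : form srt) :
  exists l : list V, forall (M : structure L) (a a' : forall v, M (srt v)),
    (forall v, List.In v l -> a v = a' v) -> (sat p a <-> sat p a').
Proof.
have [l lP] := form_psubst p; exists l => M a a' aE.
have [p' p'P] := lP V srt (fun v _ => @Var L _ srt v).
by rewrite (p'P M a a') // (p'P M a' a').
Qed.

(* Theories only consist of sentences with finitely many variables: this
   transfers inconsistency of a formula in an arbitrary context. *)
Lemma theory_of_inconsistent (L : signature) (A N : structure L) (V : Type)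
    (srt : V -> sorts L) (p : form srt) (a0 : forall v, A (srt v)) :
  is_model (theory_of A) N -> (forall a : forall v, A (srt v), ~ sat p a) ->
  forall a : forall v, N (srt v), ~ sat p a.
Proof.
move=> N_A pA a pa; have [l lP] := form_psubst p.
pose r (i : 'I_(size l)) := tnth (in_tuple l) i.
have subP v : List.In v l -> {t : term (fun i => srt (r i)) (srt v) |
    forall (B : structure L) (b : forall v, B (srt v)),
      eval (fun i => b (r i)) t = b v}.
  move=> vl; apply: cid; have [i <-] := in_tnth vl.
  by exists (@Var L _ (fun i => srt (r i)) i).
have [p' p'P] := lP _ (fun i => srt (r i)) (fun v vl => sval (subP v vl)).
(* The sentence with hypothesis [p'] and false conclusion holds in [A], hence in [N]. *)
apply: (N_A (HSentence p' (Bot _)) _ (fun i => a (r i))); last first.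
  by apply/(p'P N a) => // v vl; rewrite (svalP (subP v vl)).
move=> b /= p'b.
(* [a0] gives values to the variables outside [l]. *)
apply: (pA (fun v => if pselect (List.In v l) is left vl
                     then eval b (sval (subP v vl)) else a0 v)).
apply/(p'P A _ b) => // v vl; case: pselect => // vl'.
by rewrite (Prop_irrelevance vl vl').
Qed.

Definition Ands (L : signature) (V : Type) (srt : V -> sorts L)
    (l : list (form srt)) : form srt := foldr (@And L V srt) (Top srt) l.

Lemma sat_Ands (L : signature) (M : structure L) (V : Type)
    (srt : V -> sorts L) (l : list (form srt)) (a : forall v, M (srt v)) :
  sat (Ands l) a <-> forall p, List.In p l -> sat p a.
Proof.
elim: l => [|p l IH] /=; first by split.
split=> [[pa /IH la] q [<-//|/la]//|pl]; split; first by apply: pl; left.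
by apply/IH => q ql; apply: pl; right.
Qed.

(** * Existential quantification over blocks of variables *)

Section SingleSorted.
Variable L : signature1.
Implicit Types (M : structure L) (V W U : Type).

Local Notation ext1 := (@ext_srt L _ (fun=> tt) tt).

Definition var1 V (v : V) : @term L V (fun=> tt) tt :=
  @Var L V (fun=> tt) v.

Definition asgU M V U (b : V -> M tt) (c : U -> M tt) (w : V + U) : M tt :=
  match w with inl v => b v | inr u => c u end.

(** The variable [u] stays in the context but is sent to the bound variable, so that [q] does not
    depend on its value. *)
Lemma form_ex_var V (p : form1 L V) (u : V) :
  exists q : form1 L V, forall M (a : V -> M tt), sat q a <->
    exists x, sat p (fun v => if pselect (v = u) then x else a v).
Proof.
have [p' p'P] := @form_subst L V (option V) (fun=> tt) ext1
  (fun v => if pselect (v = u) then @Var L _ ext1 None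
            else @Var L _ ext1 (Some v)) p.
exists (Ex p') => M a /=.
have E x : sat p' (ext_asg a x) <->
    sat p (fun v => if pselect (v = u) then x else a v).
  rewrite p'P (_ : (fun v => _) =
    (fun v => if pselect (v = u) then x else a v)) //.
  by apply: funext => v; case: pselect.
by split=> -[x px]; exists x; apply/E.
Qed.

Lemma form_ex_list V (p : form1 L V) (l : list V) :
  exists q : form1 L V, forall M (a : V -> M tt), sat q a <->
    exists2 a', (forall v, ~ List.In v l -> a' v = a v) & sat p a'.
Proof.
elim: l => [|u l [q qP]].
  exists p => M a; split=> [pa|[a' aE]]; first by exists a.
  by have -> : a' = a by apply: funext => v; exact: aE.
have [q' q'P] := form_ex_var q u; exists q' => M a; rewrite q'P.
split=> [[x /qP[a' aE pa']]|[a' aE pa']].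
  exists a' => // v /=; case: (pselect (u = v)) => [?|uv] vl.
    by case: vl; left.
  rewrite aE; first by case: pselect => // vu; case: uv.
  by move=> ?; apply: vl; right.
exists (a' u); apply/qP; exists a' => // v vl.
case: pselect => [e|vu]; first by rewrite /= e.
by apply: aE => /= -[uv|//]; case: vu.
Qed.

(** The block [U] may be infinite, but only the finitely many of its variables occurring in [p] are
    quantified one by one; afterwards the whole block is sent to one further bound variable. That
    last quantifier asserts that [M] is nonempty, hence the separate treatment of empty [U]. *)
Lemma form_ex_block W U (p : form1 L (W + U)) :
  exists q : form1 L W, forall M (b : W -> M tt), sat q b <->
    exists c : U -> M tt, sat p (asgU b c).
Proof.
have [[u0]|noU] := pselect (inhabited U); last first.
  have [q qP] := @form_subst L _ W (fun=> tt) (fun=> tt)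
    (fun w => match w with inl v => var1 v
              | inr u => False_rect _ (noU (inhabits u)) end) p.
  have E M b (c : U -> M tt) : asgU b c = fun w => eval b (match w with
      | inl v => var1 v | inr u => False_rect _ (noU (inhabits u)) end).
    by apply: funext => -[//|u]; case: (noU (inhabits u)).
  exists q => M b; rewrite qP; split=> [pb|[c]]; last by rewrite E.
  by exists (fun u => False_rect _ (noU (inhabits u))); rewrite E.
have [l lP] := form_support p.
pose l' := List.filter (fun w => if w is inr _ then true else false) l.
have [q qP] := form_ex_list p l'.
have [q' q'P] := @form_subst L _ (option W) (fun=> tt) ext1
  (fun w => match w with
    | inl v => @Var L _ ext1 (Some v)
    | inr u => @Var L _ ext1 None end) q.
exists (Ex q') => M b /=.
have E x : sat q' (ext_asg b x) <-> sat q (asgU b (fun _ : U => x)).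
  rewrite q'P (_ : (fun v => _) = asgU b (fun _ : U => x)) //.
  by apply: funext => -[].
split=> [[x /E/qP[d dE pd]]|[c pc]].
  exists (d \o inr); suff -> : asgU b (d \o inr) = d by [].
  apply: funext => -[w|//] /=; rewrite dE // => /List.filter_In[_].
  by [].
exists (c u0); apply/E/qP.
exists (fun w => match w with inl v => b v
        | inr u => if pselect (List.In (inr u) l') then c u else c u0 end).
  by move=> [//|u] ul; case: pselect.
apply/(lP M _ (asgU b c)) => // -[//|u] ul /=; case: pselect => //= -[].
by apply/List.filter_In.
Qed.

End SingleSorted.
Arguments var1 {L V} v.

(** * Ultrapowers and separation in existentially closed models *)

Section Ultrapower.
Variables (L : signature) (M : structure L) (I : Type) (F : set_system I).
Hypothesis F_ultra : UltraFilter F.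

(** Quotient by equality on a set of [F], with classes encoded as subsets; symbols are interpreted
    through the chosen representatives [upow_repr]. *)
Definition upow_carrier (s : sorts L) : Type :=
  {C : set (I -> M s) | exists b, C = [set c | F [set i | b i = c i]]}.

Definition upow_class s (b : I -> M s) : upow_carrier s :=
  exist _ [set c | F [set i | b i = c i]] (ex_intro _ b erefl).

Definition upow_repr s (x : upow_carrier s) : I -> M s := sval (cid (svalP x)).

Lemma upow_reprK s (x : upow_carrier s) : upow_class (upow_repr x) = x.
Proof.
rewrite /upow_repr; case: x => C Cb; apply: eq_exist => /=.
by case: cid => b /= ->.
Qed.

Lemma upow_classE s (b c : I -> M s) :
  upow_class b = upow_class c <-> F [set i | b i = c i].
Proof.
split=> [/(congr1 sval)/= E|Fbc].
  have : [set c' | F [set i | b i = c' i]] c; last by [].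
  by rewrite E /=; apply: filterS filterT.
apply: eq_exist; apply/seteqP; split=> d /= Fd.
  by apply: filterS (filterI Fbc Fd) => i [/= <-].
by apply: filterS (filterI Fbc Fd) => i [/= ->].
Qed.

Lemma upow_repr_class s (b : I -> M s) :
  F [set i | upow_repr (upow_class b) i = b i].
Proof. by apply/upow_classE; rewrite upow_reprK. Qed.

Definition upow : structure L := @Structure L upow_carrier
  (fun f a => upow_class (fun i => finterp (fun k => upow_repr (a k) i)))
  (fun r a => F [set i | rinterp (fun k => upow_repr (a k) i)]).

Lemma upow_eval V (srt : V -> sorts L) (b : forall v, I -> M (srt v)) s
    (t : term srt s) :
  eval (M := upow) (fun v => upow_class (b v)) t =
  upow_class (fun i => eval (fun v => b v i) t).
Proof.
elim: t => [//|f ts IH] /=; apply/upow_classE.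
have : F [set i | forall k, upow_repr (upow_class
    (fun i => eval (fun v => b v i) (ts k))) i = eval (fun v => b v i) (ts k)].
  by apply: filter_forall => k; exact: upow_repr_class.
apply: filterS => i Ei /=; congr finterp.
by apply: functional_extensionality_dep => k; rewrite IH Ei.
Qed.

(** Induction on [p]: disjunction uses the maximality of [F], and the existential case a choice of
    witnesses. *)
Lemma Los V (srt : V -> sorts L) (p : form srt)
    (b : forall v, I -> M (srt v)) :
  sat (M := upow) p (fun v => upow_class (b v)) <->
  F [set i | sat p (fun v => b v i)].
Proof.
elim: p b => {V srt}
  [V srt r ts|V srt s t u|V srt|V srt|V srt p IHp q IHq|V srt p IHp q IHq|
   V srt s p IH] b /=.
- have FE : F [set i | forall k, upow_repr (upow_class
    (fun i => eval (fun v => b v i) (ts k))) i = eval (fun v => b v i) (ts k)].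
    by apply: filter_forall => k; exact: upow_repr_class.
  split=> Fr; apply: filterS (filterI FE Fr) => i [/= Ei]; congr rinterp;
  by apply: functional_extensionality_dep => k; rewrite upow_eval Ei.
- by rewrite !upow_eval upow_classE.
- by split=> // _; apply: filterS filterT.
- by split=> // /filter_ex[].
- rewrite IHp IHq; split=> [[Fp Fq]|Fpq]; first exact: filterI.
  by split; apply: filterS Fpq => i [].
- rewrite IHp IHq; split=> [[] |Fpq].
  + by apply: filterS => i; left.
  + by apply: filterS => i; right.
  have [|Fn] := in_ultra_setVsetC [set i | sat p (fun v => b v i)] F_ultra.
    by left.
  by right; apply: filterS (filterI Fn Fpq) => i /= [np []].
- have E (c : I -> M s) i :
      (fun v => (match v return I -> M (ext_srt srt s v) with
        Some v => b v | None => c end) i) = ext_asg (fun v => b v i) (c i).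
    by apply: functional_extensionality_dep => -[].
  have E' (c : I -> M s) : (fun v => upow_class
      (match v return I -> M (ext_srt srt s v) with
        Some v => b v | None => c end)) =
      @ext_asg L upow _ _ (fun v => upow_class (b v)) s (upow_class c).
    by apply: functional_extensionality_dep => -[].
  split=> [[x]|Fex].
    rewrite -(upow_reprK x) -E' => /IH.
    by apply: filterS => i /=; rewrite E; exists (upow_repr x i).
  (* The sort [s] is thus inhabited; [x0] is the default at indices without a witness. *)
  have [i0 [x0 _]] := filter_ex Fex.
  have cP i : exists x, (exists y, sat p (ext_asg (fun v => b v i) y)) ->
      sat p (ext_asg (fun v => b v i) x).
    have [[x px]|no] := pselect (exists y, sat p (ext_asg (fun v => b v i) y)).
      by exists x.
    by exists x0.
  have [c {}cP] := choice cP.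
  exists (upow_class c); rewrite -E'; apply/IH.
  by apply: filterS Fex => i /= pi; rewrite E; apply: cP.
Qed.

Lemma upow_is_model (T : theory L) : is_model T M -> is_model T upow.
Proof.
move=> MT c Tc a.
have -> : a = (fun v => upow_class (upow_repr (a v))).
  by apply: functional_extensionality_dep => v; rewrite upow_reprK.
by move=> /Los Fh; apply/Los; apply: filterS Fh => i; exact: MT.
Qed.

End Ultrapower.

(* Otherwise the positive diagram of M with parameters for [a], together with
   [p] at [a], would be finitely satisfiable in M; an ultrapower of M realising
   it contradicts existential closedness. *)
Lemma ec_separation (L : signature1) (T : theory L) (M : structure L)
    (V : Type) (p : form1 L V) (a : V -> M tt) :
  existentially_closed T M -> ~ sat p a ->
  exists2 q : form1 L V, sat q a & forall b : V -> M tt, sat p b -> ~ sat q b.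
Proof.
move=> [MT Mec] npa; apply: contrapT => noq.
have {}noq q : sat q a -> exists2 b : V -> M tt, sat p b & sat q b.
  move=> qa; apply: contrapT => nob; apply: noq; exists q => // b pb qb.
  by apply: nob; exists b.
(* The positive diagram: [inl v] names the entry [a v], and [inr m] names the element [m]. *)
pose diag := {q : form1 L (V + M tt) | sat q (asgU a id)}.
have eP (i : seq diag) : exists e : V + M tt -> M tt,
    sat p (e \o inl) /\ forall q, List.In q i -> sat (sval q) e.
  (* Quantifying out the names of elements of [M] leaves a formula true of [a], which [noq] realises
     together with [p]. *)
  have [q qP] := form_ex_block (Ands (List.map sval i)).
  have [|b pb /qP[c /sat_Ands cP]] := noq q.
    apply/qP; exists id; apply/sat_Ands => _ /List.in_map_iff[r [<- _]].
    exact: svalP r.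
  exists (asgU b c); split=> // r ri; apply: cP.
  by apply/List.in_map_iff; exists r.
have [e {}eP] := choice eP.
(* Indices are finite parts of the diagram; an ultrafilter containing every [B l] makes each formula
   of the diagram hold almost everywhere. *)
pose B (l : seq diag) :=
  [set i : seq diag | forall q, List.In q l -> List.In q i].
have FB : ProperFilter (filter_from [set: seq diag] B).
  apply: filter_from_proper; last by move=> l _; exists l => q.
  apply: filter_from_filter; first by exists nil.
  move=> i j _ _; exists (i ++ j)%list => // l lP.
  by split=> q qi; apply: lP; apply/List.in_app_iff; [left|right].
have [F [FU FF]] := ultraFilterLemma FB.
have Fdiag (q : diag) : F [set i | sat (sval q) (e i)].
  apply: FF; exists [:: q] => // i iP; apply: (eP i).2; apply: iP; by left.
pose h s : M s -> upow M F s := match s with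
  tt => fun m => upow_class F (fun i => e i (inr m)) end.
apply: npa.
apply: (Mec (upow M F) h); first exact: upow_is_model.
  move=> W srt q c qc.
  have srtE : srt = fun=> tt by apply: funext => w; case: (srt w).
  move: q c qc; rewrite srtE => q c qc.
  apply/(Los FU q (fun w i => e i (inr (c w)))).
  have [q' q'P] := @form_subst L _ (V + M tt) (fun=> tt) (fun=> tt)
    (fun w => var1 (inr (c w))) q.
  have q'c : sat q' (asgU a id) by apply/q'P.
  apply: filterS (Fdiag (exist _ q' q'c)) => i /=.
  by move/q'P.
(* The equation between the two names of [a v] belongs to the diagram. *)
have -> : (fun v => h tt (a v)) =
    (fun v => upow_class F (fun i => e i (inl v))).
  apply: funext => v; apply/upow_classE.
  pose q : form1 L (V + M tt) := Eq (var1 (inr (a v))) (var1 (inl v)).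
  exact: (Fdiag (exist _ q erefl)).
apply/(Los FU p (fun v i => e i (inl v))).
by apply: filterS filterT => i _; exact: (eP i).1.
Qed.

(** * Cardinality and small sets *)

Lemma inj_card_leT (X Y : Type) (f : X -> Y) :
  injective f -> ([set: X] #<= [set: Y])%card.
Proof.
move=> f_inj; have : (f @` [set: X] #= [set: X])%card.
  by apply: inj_card_eq => x y _ _; exact: f_inj.
rewrite card_eq_le => /andP[_] /card_le_trans; apply.
exact: subset_card_le.
Qed.

Lemma surj_card_leT (X Y : Type) (A : set Y) (f : X -> Y) :
  A `<=` range f -> (A #<= [set: X])%card.
Proof.
by move=> Af; apply: card_le_trans (subset_card_le Af) (card_image_le _ _).
Qed.

Section Small.
Variable K : Type.

Lemma small_le (X Y : Type) (A : set X) (B : set Y) :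
  (A #<= B)%card -> small K B -> small K A.
Proof.
move=> AB [BK KB]; split; first exact: card_le_trans BK.
by move=> KA; apply: KB; exact: card_le_trans AB.
Qed.

Lemma small_image (X Y : Type) (f : X -> Y) (A : set X) :
  small K A -> small K (f @` A).
Proof. exact/small_le/card_image_le. Qed.

Lemma small_inj (X Y : Type) (f : X -> Y) :
  injective f -> small K [set: Y] -> small K [set: X].
Proof. by move=> f_inj; apply: small_le; exact: inj_card_leT f_inj. Qed.

Lemma small_surj (X Y : Type) (A : set Y) (f : X -> Y) :
  A `<=` range f -> small K [set: X] -> small K A.
Proof. by move=> Af; apply: small_le; exact: surj_card_leT Af. Qed.

Lemma small_sub (X : Type) (A B : set X) : A `<=` B -> small K B -> small K A.
Proof. by move=> AB; apply: small_le; exact: subset_card_le. Qed.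

Lemma small_sig (X : Type) (A : set X) :
  small K A -> small K [set: {x | A x}].
Proof.
apply: small_le; have : (sval @` [set: {x | A x}] #= [set: {x | A x}])%card.
  apply: inj_card_eq => -[x Ax] [y Ay] _ _ /= xy; exact: eq_exist.
rewrite card_eq_le => /andP[_] /card_le_trans; apply.
by apply: subset_card_le => _ [[x Ax] _ <-].
Qed.

Hypothesis K_reg : uncountable_regular K.

Lemma small_nat : small K [set: nat]. Proof. exact: K_reg.1. Qed.

Lemma small_count (X : countType) : small K [set: X].
Proof. exact: small_inj (pcan_inj (@pickleK X)) small_nat. Qed.

Lemma small_sigT (J : Type) (A : J -> Type) :
  small K [set: J] -> (forall j, small K [set: A j]) ->
  small K [set: {j & A j}].
Proof. exact: K_reg.2. Qed.

Lemma small_bigcup (J X : Type) (A : J -> set X) :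
  small K [set: J] -> (forall j, small K (A j)) ->
  small K (\bigcup_j A j).
Proof.
move=> sJ sA.
apply: (@small_surj {j & {x | A j x}} X _ (fun jx => sval (projT2 jx))).
  by move=> x [j _ Ax]; exists (existT _ j (exist _ x Ax)).
by apply: small_sigT => // j; exact: small_sig.
Qed.

Lemma small_sum (X Y : Type) :
  small K [set: X] -> small K [set: Y] -> small K [set: X + Y].
Proof.
move=> sX sY.
apply: (@small_surj {b : bool & if b then X else Y} _ _ (fun u => match u with
  existT true x => inl x | existT false y => inr y end)).
  by move=> [x|y] _; [exists (existT _ true x : {b : bool & if b then X else Y})
    |exists (existT _ false y : {b : bool & if b then X else Y})].
apply: small_sigT; first exact: small_count.
by case.
Qed.

Lemma small_prod (X Y : Type) :
  small K [set: X] -> small K [set: Y] -> small K [set: X * Y].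
Proof.
move=> sX sY.
apply: (@small_surj {x : X & Y} _ _ (fun u => (projT1 u, projT2 u))).
  by move=> [x y] _; exists (existT _ x y).
exact: small_sigT.
Qed.

Lemma small_setU (X : Type) (A B : set X) :
  small K A -> small K B -> small K (A `|` B).
Proof.
move=> sA sB.
apply: (@small_surj ({x | A x} + {x | B x}) _ _
  (fun u => match u with inl x => sval x | inr x => sval x end)).
  move=> x [Ax|Bx]; first by exists (inl (exist _ x Ax)).
  by exists (inr (exist _ x Bx)).
by apply: small_sum; exact: small_sig.
Qed.

Lemma small_set1 (X : Type) (x : X) : small K [set x].
Proof.
apply: (@small_surj unit _ _ (fun=> x)); last exact: small_count.
by move=> _ ->; exists tt.
Qed.

(** Sequences form a countable union, over their lengths, of iterated products; regularity and
    uncountability of [K] keep it small. *)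
Lemma small_seq (X : Type) : small K [set: X] -> small K [set: seq X].
Proof.
move=> sX; pose S n := [set s : seq X | size s = n].
have sS n : small K (S n).
  elim: n => [|n IH].
    by apply: small_sub (small_set1 [::]) => -[].
  apply: (@small_surj (X * {s | S n s}) _ _ (fun u => u.1 :: sval u.2)).
    by move=> [//|x s] [ss]; exists (x, exist _ s ss).
  by apply: small_prod => //; exact: small_sig.
apply: small_sub (small_bigcup small_nat sS) => s _.
by exists (size s).
Qed.

End Small.

(** * Counting formulas by an injective coding *)

Section Coding.
Variables (L : signature) (B : Type).

(** A quantifier changes the context and with it the type of formulas; finite labelled trees give
    one common target for an injection. The labels in [B] stand for variables. *)
Definition code : Type := GenTree.tree (sorts L + Defs.fsym L + rsym L + B).

Lemma small_code K : uncountable_regular K -> small_signature K L ->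
  small K [set: B] -> small K [set: code].
Proof.
move=> K_reg [sS sF sR] sB.
apply: small_inj (pcan_inj (@GenTree.codeK _)) _.
apply: small_seq => //; apply: small_sum => //; first exact: small_count.
by do 3 apply: small_sum => //.
Qed.

Fixpoint tcode V (srt : V -> sorts L) (c : V -> code) s (t : term srt s) :
    code :=
  match t with
  | Var v => GenTree.Node 0 [:: c v]
  | App f ts => GenTree.Node 1 (GenTree.Leaf (inl (inl (inr f))) ::
      [seq tcode c (ts i) | i <- enum (farity f)])
  end.

(** The root separates the new bound variable from the old ones, which keeps the naming of variables
    injective. *)
Definition ext_code V (c : V -> code) (o : option V) : code :=
  if o is Some v then GenTree.Node 0 [:: c v] else GenTree.Node 1 [::].

Fixpoint fcode V (srt : V -> sorts L) (c : V -> code) (p : form srt) : code :=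
  match p with
  | Rel r ts => GenTree.Node 0 (GenTree.Leaf (inl (inr r)) ::
      [seq tcode c (ts i) | i <- enum (rarity r)])
  | Eq _ t u => GenTree.Node 1 [:: tcode c t; tcode c u]
  | Top => GenTree.Node 2 [::]
  | Bot => GenTree.Node 3 [::]
  | And p q => GenTree.Node 4 [:: fcode c p; fcode c q]
  | Or p q => GenTree.Node 5 [:: fcode c p; fcode c q]
  | Ex s p => GenTree.Node 6
      [:: GenTree.Leaf (inl (inl (inl s))); fcode (ext_code c) p]
  end.

Lemma existT_snd_inj (X : Type) (P : X -> Type) x (u v : P x) :
  existT P x u = existT P x v -> u = v.
Proof.
move=> E; have := projT2_eq E.
by rewrite (Prop_irrelevance (projT1_eq E) erefl).
Qed.

Lemma tcode_args V (srt : V -> sorts L) (c : V -> code) (I : finType)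
    (d : I -> sorts L) (ts us : forall i, term srt (d i)) :
  (forall i s (u : term srt s), tcode c (ts i) = tcode c u ->
     existT _ _ (ts i) = existT _ _ u) ->
  [seq tcode c (ts i) | i <- enum I] = [seq tcode c (us i) | i <- enum I] ->
  ts = us.
Proof.
move=> IH E; apply: functional_extensionality_dep => i.
apply: existT_snd_inj; apply: IH.
by move/eq_in_map: E => /(_ i (mem_enum _ _)).
Qed.

(** The two sorts are not known in advance to agree, so terms are compared as dependent pairs. *)
Lemma tcode_inj V (srt : V -> sorts L) (c : V -> code) : injective c ->
  forall s (t : term srt s) s' (t' : term srt s'),
  tcode c t = tcode c t' -> existT _ _ t = existT _ _ t'.
Proof.
move=> c_inj s; elim=> [v|f ts IH] s' [v'|f' ts'] //=.
  by case=> /c_inj ->.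
case=> fE; move: ts'; rewrite -fE => ts' E.
by rewrite (tcode_args IH E).
Qed.

Lemma fcode_inj V (srt : V -> sorts L) (c : V -> code) : injective c ->
  injective (@fcode V srt c).
Proof.
move=> c_inj p; elim: p c c_inj => {V srt}
  [V srt r ts|V srt s t u|V srt|V srt|V srt p IHp q IHq|V srt p IHp q IHq|
   V srt s p IH] c c_inj [r' ts'|s' t' u'|||p' q'|p' q'|s' p'] //=.
- case=> rE; move: ts'; rewrite -rE => ts' E.
  by rewrite (tcode_args (fun i => tcode_inj c_inj (t := ts i)) E).
- case=> /(tcode_inj c_inj) tE /(tcode_inj c_inj) uE.
  move: (projT1_eq tE) => /= sE; move: t' u' tE uE; rewrite -sE => t' u'.
  by move=> tE uE; rewrite (existT_snd_inj tE) (existT_snd_inj uE).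
- by case=> /(IHp _ c_inj) -> /(IHq _ c_inj) ->.
- by case=> /(IHp _ c_inj) -> /(IHq _ c_inj) ->.
- case=> sE; move: p'; rewrite -sE => p' /IH -> //.
  by move=> [x|] [y|] //= [/c_inj ->].
Qed.

End Coding.

Lemma small_form (K : Type) (L : signature) (V : Type) (srt : V -> sorts L) :
  uncountable_regular K -> small_signature K L -> small K [set: V] ->
  small K [set: form srt].
Proof.
move=> K_reg sL sV.
apply: (@small_inj K _ (code L V) (fcode (fun v => GenTree.Leaf (inr v)))).
  by apply: fcode_inj => v v' [].
exact: small_code.
Qed.

Lemma finite_set_list (X : Type) (A : set X) :
  finite_set A <-> exists l : list X, forall x, A x <-> List.In x l.
Proof.
split=> [/(@finite_seqP {classic X})[l ->]|[l lP]].
  exists l => x; rewrite /mkset /=; elim: l => //= y l IH; rewrite in_cons.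
  split=> [/orP[/eqP->|/IH]|[->|/IH ->]]; [by left|by right| |].
    by rewrite eqxx.
  by rewrite orbT.
have -> : A = [set x | List.In x l] by apply/seteqP; split=> x /lP.
elim: l {lP} => [|y l IH]; first exact: finite_set0.
have -> : [set x | List.In x (y :: l)] = [set y] `|` [set x | List.In x l].
  by apply/seteqP; split=> x [->|]; [left|right|left|right].
by rewrite finite_setU; split=> //; exact: finite_set1.
Qed.

Lemma list_choice (X Y : Type) (Q : X -> Y -> Prop) (l : list X) :
  (forall x, List.In x l -> exists y, Q x y) ->
  exists m : list Y, forall x, List.In x l -> exists2 y, List.In y m & Q x y.
Proof.
elim: l => [|x l IH] lQ; first by exists nil.
have [y xy] := lQ x (or_introl erefl).
have [|m mP] := IH; first by move=> z zl; apply: lQ; right.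
exists (y :: m) => z /= [<-|/mP[w wm zw]]; first by exists y => //; left.
by exists w => //; right.
Qed.

(** * Type-definable predicates in a saturated structure *)

Section TypeDefinable.
Variables (L : signature1) (K : Type) (M : structure L).
Hypotheses (K_reg : uncountable_regular K) (L_small : small_signature K L).

(** Definability by a small partial type without parameters; parameters enter later as values of
    variables in [W]. *)
Definition tdef (W : Type) (P : (W -> M tt) -> Prop) : Prop :=
  exists2 S : set (form1 L W), small K S &
    forall b, P b <-> forall q, S q -> sat q b.

Lemma tdef_iff (W : Type) (P Q : (W -> M tt) -> Prop) :
  (forall b, P b <-> Q b) -> tdef P -> tdef Q.
Proof. by move=> PQ [S sS SP]; exists S => // b; rewrite -PQ. Qed.

Lemma tdef_form (W : Type) (p : form1 L W) : tdef (fun b => sat p b).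
Proof.
exists [set p]; first exact: small_set1.
by move=> b; split=> [pb _ ->|]; last exact.
Qed.

Lemma tdef_set (W : Type) (S : set (form1 L W)) : small K [set: W] ->
  tdef (fun b => forall q, S q -> sat q b).
Proof.
by move=> sW; exists S => //; apply: small_sub (small_form _ _ _ sW).
Qed.

Lemma tdef_forall (W J : Type) (P : J -> (W -> M tt) -> Prop) :
  small K [set: J] -> (forall j, tdef (P j)) -> tdef (fun b => forall j, P j b).
Proof.
move=> sJ tP; pose S j := s2val (cid2 (tP j)).
exists (\bigcup_j S j).
  by apply: small_bigcup => // j; rewrite /S; case: cid2.
move=> b; split=> [Pb q [j _]|Sb j].
  by move: (Pb j); rewrite /S; case: cid2 => S' /= _ -> S'b /S'b.
have := fun q Sq => Sb q (ex_intro2 _ _ j I Sq).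
by rewrite /S; case: cid2 => S' /= _ E; rewrite E.
Qed.

Lemma tdef_and (W : Type) (P Q : (W -> M tt) -> Prop) :
  tdef P -> tdef Q -> tdef (fun b => P b /\ Q b).
Proof.
move=> [S sS SP] [S' sS' SQ]; exists (S `|` S'); first exact: small_setU.
move=> b; rewrite SP SQ; split=> [[Sb S'b] q [/Sb|/S'b]//|SSb].
by split=> q qS; apply: SSb; [left|right].
Qed.

(** By distributivity, a disjunction of two conjunctions is the conjunction of all [Or p q] with [p]
    in [S] and [q] in [S']. *)
Lemma tdef_or (W : Type) (P Q : (W -> M tt) -> Prop) :
  tdef P -> tdef Q -> tdef (fun b => P b \/ Q b).
Proof.
move=> [S sS SP] [S' sS' SQ].
exists ((fun pq : {p | S p} * {q | S' q} =>
  Or (sval pq.1) (sval pq.2)) @` setT).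
  by apply/small_image/small_prod => //; exact: small_sig.
move=> b; rewrite SP SQ; split.
  by move=> [Sb|S'b] _ [[[p Sp] [q Sq]] _ <-] /=;
    [left; exact: Sb|right; exact: S'b].
move=> pq; have [|/existsNP[p /not_implyP[Sp np]]] :=
  pselect (forall q, S q -> sat q b).
  by left.
right=> q Sq.
have := pq _ (imageT _ (exist _ p Sp, exist _ q Sq)).
by case.
Qed.

Lemma tdef_subst (W W' : Type) (sub : W -> @term L W' (fun=> tt) tt)
    (P : (W -> M tt) -> Prop) :
  tdef P -> tdef (fun b => P (fun w => eval b (sub w))).
Proof.
move=> [S sS SP].
exists ((fun p : form1 L W =>
  sval (@form_subst L _ _ _ (fun=> tt) sub p)) @` S).
  exact: small_image.
move=> b; rewrite SP; split=> [Sb _ [p Sp <-]|S'b p Sp].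
  by apply/(svalP (form_subst _ _)); exact: Sb.
by apply/(svalP (form_subst sub p)); apply: S'b; exists p.
Qed.

Hypothesis M_sat : very_saturated K M.

(** Saturation for type-definable conditions: the coordinates of [b] become parameters, and a finite
    part of the resulting type comes from finitely many [P j]. *)
Lemma tdef_realise (U W J : Type) (b : W -> M tt)
    (P : J -> (W + U -> M tt) -> Prop) :
  small K [set: U] -> small K [set: J] -> (forall j, tdef (P j)) ->
  (forall l : list J, exists c : U -> M tt,
     forall j, List.In j l -> P j (asgU b c)) ->
  exists c : U -> M tt, forall j, P j (asgU b c).
Proof.
move=> sU sJ tP Pfin; pose S j := s2val (cid2 (tP j)).
have sS j : small K (S j) by rewrite /S; case: cid2.
have SP j d : P j d <-> forall q, S j q -> sat q d by rewrite /S; case: cid2.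
pose sub (w : W + U) : @term L _ (@par_srt L M U (fun=> tt)) tt :=
  match w with
  | inl w => @Var L _ (@par_srt L M U (fun=> tt)) (inr (existT _ tt (b w)))
  | inr u => @Var L _ (@par_srt L M U (fun=> tt)) (inl u)
  end.
pose inst (q : form1 L (W + U)) := sval (@form_subst L _ _ _ _ sub q).
have instP q c : sat (inst q) (par_asg c) <-> sat q (asgU b c).
  rewrite (svalP (@form_subst L _ _ _ _ sub q)).
  rewrite (_ : (fun _ => _) = asgU b c) //.
  by apply: funext => -[].
have [||F /finite_set_list[l lP] Fsub|c cP] :=
    M_sat (V := U) (srt := fun=> tt) (Sigma := \bigcup_j (inst @` S j)).
- exact: sU.
- by apply: small_bigcup => // j; exact: small_image.
- have [|m mP] := @list_choice _ _ (fun p j => (inst @` S j) p) l.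
    by move=> p /lP/Fsub[j _ ?]; exists j.
  have [c cP] := Pfin m; exists c => p /lP/mP[j jm [q Sq <-]].
  by apply/instP; move: q Sq; apply/SP; exact: cP.
- exists c => j; apply/SP => q Sq; apply/instP; apply: cP.
  by exists j => //; exists q.
Qed.

(** By saturation a suitable [c] exists as soon as every finite part of the type has one, and each
    such finite statement is a single formula by [form_ex_block]. *)
Lemma tdef_ex (U W : Type) (P : (W + U -> M tt) -> Prop) :
  small K [set: U] -> tdef P -> tdef (fun b => exists c, P (asgU b c)).
Proof.
move=> sU [S sS SP].
pose ex (l : seq {q | S q}) :=
  sval (cid (form_ex_block (Ands (List.map sval l)))).
have exP l := svalP (cid (form_ex_block (Ands (List.map sval l)))).
rewrite -/(ex _) in exP.
have {}exP (l : seq {q | S q}) (b : W -> M tt) : sat (ex l) b <->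
    exists c : U -> M tt, forall q, List.In q l -> sat (sval q) (asgU b c).
  rewrite exP; split=> -[c cP]; exists c.
    move=> q ql; move/sat_Ands: cP; apply.
    by apply/List.in_map_iff; exists q.
  by apply/sat_Ands => _ /List.in_map_iff[q [<- ql]]; exact: cP.
exists (ex @` setT).
  by apply/small_image/small_seq => //; exact: small_sig.
move=> b; split=> [[c /SP cP] _ [l _ <-]|exb].
  by apply/exP; exists c => q _; apply: cP; exact: svalP q.
have [|||l|c cP] := @tdef_realise U W {q | S q} b (fun q => sat (sval q)).
- exact: sU.
- exact: small_sig.
- by move=> q; exact: tdef_form.
- by apply/exP; apply: exb; exists l.
- by exists c; apply/SP => q Sq; exact: (cP (exist _ q Sq)).
Qed.

End TypeDefinable.

(** * Translation between formulas of [LE] and of [L] *)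

Section Translation.
Variables (L : signature1) (K : Type) (M : structure L) (EE : ptype_family L).
Hypotheses (K_reg : uncountable_regular K) (L_small : small_signature K L).
Hypothesis M_sat : very_saturated K M.
Hypothesis EE_small : forall E : EE, small K [set: ptlen E].
Hypothesis EE_equiv : defines_equivalences EE M.

Local Notation LE := (hyper_sig EE).
Local Notation ME := (hyper_struct EE M).

(* An element of sort [s] is represented by a real tuple indexed by [slot s]. *)
Definition slot (s : sorts LE) : Type :=
  match s with None => unit | Some E => ptlen E end.

Definition flat (V : Type) (srt : V -> sorts LE) : Type :=
  {v : V & slot (srt v)}.

Definition proj (s : sorts LE) : (slot s -> M tt) -> ME s :=
  match s return (slot s -> M tt) -> ME s with
  | None => fun b => b tt
  | Some E => fun b => exist _ [set c | ptrel b c] (ex_intro _ b erefl)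
  end.

Lemma small_slot s : small K [set: slot s].
Proof. by case: s => [E|] //=; exact: small_count. Qed.

Lemma small_flat (V : Type) (srt : V -> sorts LE) :
  small K [set: V] -> small K [set: flat srt].
Proof. by move=> sV; apply: small_sigT => // v; exact: small_slot. Qed.

Lemma proj_surj s (x : ME s) : exists b : slot s -> M tt, proj b = x.
Proof.
case: s x => [E|] x /=; last by exists (fun=> x).
by case: x => C [b CE]; exists b; apply: eq_exist.
Qed.

Definition repr s (x : ME s) : slot s -> M tt := sval (cid (proj_surj x)).

Lemma reprK s (x : ME s) : proj (repr x) = x.
Proof. exact: svalP (cid (proj_surj x)). Qed.

Lemma proj_eq (E : EE) (b c : ptlen E -> M tt) :
  @proj (Some E) b = @proj (Some E) c <-> ptrel b c.
Proof.
have [rf sy tn] := EE_equiv E; split=> [/(congr1 sval)/= bc|bc].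
  have : [set d | ptrel b d] c; last by [].
  by rewrite bc; exact: rf.
apply: eq_exist; apply/seteqP; split=> d /= H; last exact: tn bc H.
by apply: tn H; exact: sy.
Qed.

Lemma mem_hyper_class (E : EE) (x : ME (Some E)) (c : ptlen E -> M tt) :
  sval x c <-> x = @proj (Some E) c.
Proof. by rewrite -{2}(reprK x) proj_eq -{1}(reprK x). Qed.

Definition projA (V : Type) (srt : V -> sorts LE) (b : flat srt -> M tt)
    (v : V) : ME (srt v) := proj (fun k => b (existT _ v k)).

Lemma projA_repr (V : Type) (srt : V -> sorts LE) (a : forall v, ME (srt v)) :
  projA (fun w => repr (a (projT1 w)) (projT2 w)) = a.
Proof. by apply: functional_extensionality_dep => v; exact: (reprK (a v)). Qed.

(** Every function symbol takes values in the real sort, so a term of a sort $S_E$ is a variable and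
    its coordinates are again variables. *)
Fixpoint tr (V : Type) (srt : V -> sorts LE) (s : sorts LE) (t : term srt s) :
    slot s -> @term L (flat srt) (fun=> tt) tt :=
  match t with
  | Var v => fun k => var1 (existT _ v k)
  | App f ts => fun _ => @App L _ (fun=> tt) f (fun i => tr (ts i) tt)
  end.

Lemma eval_tr (V : Type) (srt : V -> sorts LE) (b : flat srt -> M tt) s
    (t : term srt s) : eval (projA b) t = proj (fun k => eval b (tr t k)).
Proof.
elim: t => [//|f ts IH] /=; rewrite /hyper_finterp.
congr finterp; apply: functional_extensionality_dep => i.
exact: IH.
Qed.

Local Notation tdef := (@tdef L K M _).

(** Equality in $S_E$ is the relation defined by the partial type $E$; this is why formulas of [LE]
    become types rather than single formulas. *)
Lemma tdef_proj_eq s : tdef (fun d : slot s + slot s -> M tt =>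
  proj (fun k => d (inl k)) = proj (fun k => d (inr k))).
Proof.
case: s => [E|] /=.
  have sE : small K [set: ptlen E + ptlen E] by exact: small_sum.
  apply: tdef_iff (tdef_set M K_reg L_small (ptype E) sE) => d.
  rewrite proj_eq /ptrel.
  suff -> : (fun w => match w with inl i => d (inl i) | inr i => d (inr i) end)
    = d by [].
  by apply: funext => -[].
exact: (tdef_form M K_reg (Eq (var1 (inl tt)) (var1 (inr tt)))).
Qed.

(** Induction on [p]. Representatives are existentially quantified in $R_\varphi$ and under a
    quantifier of [LE], and there [tdef_ex] applies. *)
Lemma hyper_tdef (V : Type) (srt : V -> sorts LE) (p : form srt) :
  tdef (fun b : flat srt -> M tt => sat (M := ME) p (projA b)).
Proof.
elim: p => {V srt}
  [V srt [r|R] ts|V srt s t u|V srt|V srt|V srt p IHp q IHq|V srt p IHp q IHq|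
   V srt s p IH].
- apply: tdef_iff (tdef_form M K_reg
    (@Rel L _ (fun=> tt) r (fun i => tr (ts i : term srt None) tt))) => b /=.
  suff -> : (fun i => eval (M := ME) (projA b) (ts i)) =
      (fun i => eval b (tr (ts i : term srt None) tt)) by [].
  by apply: functional_extensionality_dep => i; rewrite eval_tr.
- pose U := {j : 'I_(hn R) & ptlen (hE j)}.
  pose tx i : term srt None := ts (inl i).
  pose ty j : term srt (Some (hE j)) := ts (inr j).
  pose wk (t : @term L (flat srt) (fun=> tt) tt) :
      @term L (flat srt + U) (fun=> tt) tt :=
    sval (term_subst (fun w => var1 (inl w)) t).
  have wkP t (d : flat srt + U -> M tt) : eval d (wk t) = eval (d \o inl) t.
    by rewrite (svalP (term_subst _ t)).
  (* The condition for [j] will say that the argument [ty j] is the class of the tuple formed by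
     block [j] of [U]. *)
  pose subE j (k : ptlen (hE j) + ptlen (hE j)) := match k with
    | inl k => wk (tr (ty j) k)
    | inr k => var1 (inr (existT _ j k) : flat srt + U) end.
  pose subphi (w : 'I_(hx R) + U) := match w with
    | inl i => wk (tr (tx i) tt)
    | inr u => var1 (inr u : flat srt + U) end.
  have sU : small K [set: U] by apply: small_sigT => //; exact: small_count.
  have tQ : tdef (fun d : flat srt + U -> M tt =>
      (forall j,
         proj (fun k : slot (Some (hE j)) => eval d (subE j (inl k))) =
         proj (fun k : slot (Some (hE j)) => eval d (subE j (inr k)))) /\
      sat (hphi R) (fun w => eval d (subphi w))).
    apply: tdef_and => //.
      apply: tdef_forall => //; first exact: small_count.
      move=> j; exact: (tdef_subst (subE j) (tdef_proj_eq (Some (hE j)))).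
    exact: (tdef_subst subphi (tdef_form M K_reg (hphi R))).
  apply: tdef_iff (tdef_ex K_reg M_sat sU tQ) => b /=.
  have asgE c : (fun w => eval (asgU b c) (subphi w)) =
      fun w => match w with
               | inl i => eval (M := ME) (projA b) (tx i)
               | inr jk => c (existT _ (projT1 jk) (projT2 jk)) end.
    by apply: funext => -[i|[j k]] //=; rewrite wkP eval_tr.
  have memE c j :
      proj (fun k : slot (Some (hE j)) => eval (asgU b c) (subE j (inl k))) =
      proj (fun k : slot (Some (hE j)) => eval (asgU b c) (subE j (inr k))) <->
      sval (eval (M := ME) (projA b) (ty j)) (fun k => c (existT _ j k)).
    rewrite mem_hyper_class eval_tr.
    by rewrite (_ : (fun k => eval _ (subE j (inl k))) =
      (fun k => eval b (tr (ty j) k))) //; apply: funext => k /=; rewrite wkP.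
  split=> [[c [cE cphi]]|[c [cE cphi]]].
    exists (fun j k => c (existT _ j k)); split=> [j|].
      exact: (iffLR (memE c j) (cE j)).
    by rewrite asgE in cphi.
  exists (fun u => c (projT1 u) (projT2 u)); split=> [j|].
    exact: (iffRL (memE _ j) (cE j)).
  by rewrite asgE.
- pose sub (k : slot s + slot s) :=
    match k with inl k => tr t k | inr k => tr u k end.
  apply: tdef_iff (tdef_subst sub (tdef_proj_eq s)) => b /=.
  by rewrite !eval_tr.
- exact: (tdef_form M K_reg (Top _)).
- exact: (tdef_form M K_reg (Bot _)).
- exact: tdef_and.
- exact: tdef_or.
(* The coordinates of the bound variable form the block [slot s] to be quantified. *)
- pose sub (w : flat (ext_srt srt s)) :
      @term L (flat srt + slot s) (fun=> tt) tt :=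
    match w with
    | existT o k =>
      match o return slot (ext_srt srt s o) ->
          @term L (flat srt + slot s) (fun=> tt) tt with
      | Some v => fun k => var1 (inl (existT _ v k))
      | None => fun k => var1 (inr k)
      end k
    end.
  apply: tdef_iff
    (tdef_ex K_reg M_sat (small_slot s) (tdef_subst sub IH)) => b /=.
  have E c : projA (fun w => eval (asgU b c) (sub w)) =
      ext_asg (projA b) (proj c).
    by apply: functional_extensionality_dep => -[].
  split=> [[c]|[x]]; first by rewrite E; exists (proj c).
  by exists (repr x); rewrite E reprK.
Qed.

(** Although [flat srt] may be infinite, [p] uses finitely many coordinates, so it concerns finitely
    many entries of [e] and is expressed by one relation $R_\varphi$ between them. *)
Lemma hyper_form_repr (V : Type) (srt : V -> sorts LE)
    (p : form1 L (flat srt)) :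
  exists q : form srt, forall e : (forall v, ME (srt v)),
    sat q e <-> exists2 y : flat srt -> M tt, projA y = e & sat p y.
Proof.
have [l lP] := form_psubst p.
(* Matching on the sort of a term separates real from hyperimaginary variables without transport
   along equalities of sorts. *)
pose re s : term srt s -> list (term srt None) :=
  match s with None => fun t => [:: t] | Some _ => fun _ => [::] end.
pose hy s : term srt s -> list {E & term srt (Some E)} :=
  match s with None => fun _ => [::] | Some E => fun t => [:: existT _ E t] end.
pose lr := List.flat_map (fun w : flat srt => re _ (Var srt (projT1 w))) l.
pose lh := List.flat_map (fun w : flat srt => hy _ (Var srt (projT1 w))) l.
pose tx i := tnth (in_tuple lr) i.
pose E j := projT1 (tnth (in_tuple lh) j).
pose ty j : term srt (Some (E j)) := projT2 (tnth (in_tuple lh) j).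
pose W := ('I_(size lr) + {j : 'I_(size lh) & ptlen (E j)})%type.
pose full (e : forall v, ME (srt v)) (b : forall j, ptlen (E j) -> M tt)
    (w : W) :=
  match w with
  | inl i => eval (M := ME) e (tx i) : M tt
  | inr jk => b (projT1 jk) (projT2 jk)
  end.
(* [rho] locates the coordinates of [t] among the variables of $\varphi$, both for arbitrary
   representatives [b] and for those read off from a tuple [y]. *)
pose good s (t : term srt s) (rho : slot s -> W) :=
  (forall e b, (forall j, sval (eval (M := ME) e (ty j)) (b j)) ->
     proj (fun k => full e b (rho k)) = eval (M := ME) e t) /\
  (forall y k, full (projA y) (fun j k => eval y (tr (ty j) k)) (rho k) =
     eval y (tr t k)).
have goodP s (t : term srt s) :
    (forall x, List.In x (re _ t) -> List.In x lr) ->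
    (forall x, List.In x (hy _ t) -> List.In x lh) -> exists rho, good s t rho.
  rewrite /good; case: s t => [F|] t /= tlr tlh; last first.
    have [i iE] := in_tnth (tlr _ (or_introl erefl)).
    exists (fun=> inl i); split=> [e b _|y []] /=; rewrite /tx iE //.
    by rewrite eval_tr.
  have [j jE] := in_tnth (tlh _ (or_introl erefl)).
  suff : forall u, tnth (in_tuple lh) j = u ->
      exists rho, good (Some (projT1 u)) (projT2 u) rho by move/(_ _ jE).
  move=> _ <-; exists (fun k => inr (existT _ j k)); split=> [e b bP|//] /=.
  by symmetry; apply/mem_hyper_class; exact: bP.
(* The place is chosen for a variable, not for a single coordinate, so that all coordinates of a
   class are read from the same representative. *)
have rhoP v : List.In v (List.map (fun w : flat srt => projT1 w) l) ->
    {rho : slot (srt v) -> W | good _ (Var srt v) rho}.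
  move=> vl; apply: cid; have [w [wE wl]] := proj1 (List.in_map_iff _ _ _) vl.
  by apply: goodP => x xv; apply/List.in_flat_map; exists w; rewrite wE.
have inV (w : flat srt) (wl : List.In w l) :
    List.In (projT1 w) (List.map (fun w : flat srt => projT1 w) l).
  by apply/List.in_map_iff; exists w.
have [p' p'P] := lP W (fun=> tt)
  (fun w wl => var1 (sval (rhoP _ (inV w wl)) (projT2 w))).
pose R : hrsym EE := @HRsym L EE (size lr) (size lh) E p'.
pose args (i : rarity (inr R : rsym LE)) :
    term srt (rdom (inr R : rsym LE) i) :=
  match i with inl i => tx i | inr j => ty j end.
exists (@Rel LE V srt (inr R) args) => e; split=> /=.
  move=> [b [bP p'b]].
  (* Variables without a coordinate in [l] keep an arbitrary representative. *)
  exists (fun w => if pselect (List.In (projT1 w)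
      (List.map (fun w : flat srt => projT1 w) l)) is left vl
    then full e b (sval (rhoP _ vl) (projT2 w))
    else repr (e (projT1 w)) (projT2 w)).
    apply: functional_extensionality_dep => v; rewrite /projA /=.
    case: pselect => vl; last exact: reprK.
    by have [gP _] := svalP (rhoP v vl); rewrite gP.
  apply/(p'P M _ (full e b)) => // w wl.
  case: pselect => [vl|[]]; last exact: (inV w wl).
  by rewrite (Prop_irrelevance vl (inV w wl)).
move=> [y <- py]; exists (fun j k => eval y (tr (ty j) k)); split=> [j|].
  by apply/mem_hyper_class; rewrite eval_tr.
apply/(p'P M y) => // -[v k] wl /=.
by have [_ gP] := svalP (rhoP v (inV _ wl)); rewrite /= -[LHS]gP.
Qed.

(** * Existential closedness and saturation *)

Lemma hyper_existentially_closed (T : theory L) :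
  existentially_closed T M -> existentially_closed (hyper_theory EE M) ME.
Proof.
move=> Mec; split=> [c //|N h N_model h_hom V srt p a pha].
apply: contrapT; rewrite -(projA_repr a).
set b := fun w => _; have [S _ SP] := hyper_tdef p.
move=> /SP/existsNP[q /not_implyP[Sq nqb]].
have [r rb rP] := ec_separation Mec nqb.
have [q' q'P] := hyper_form_repr r.
(* [p] and [q'] exclude each other in [ME], as a common solution would have representatives
   satisfying both [q] and [r]; this passes to [N], where both hold at the image of [a]. *)
apply: (theory_of_inconsistent (p := And p q') a N_model _ (conj pha _)).
  move=> a' [pa' /q'P[y yE]]; move: pa'; rewrite -yE => /SP yS.
  exact/rP/yS.
by apply: h_hom; apply/q'P; exists b => //; exact: projA_repr.
Qed.

Lemma hyper_saturated : very_saturated K ME.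
Proof.
move=> V srt Sigma sV sSigma fin.
(* Every element of [ME] may be a parameter; [b] lists chosen representatives of all of them. *)
pose W := @flat {s & ME s} (fun m => projT1 m).
pose b (w : W) := repr (projT2 (projT1 w)) (projT2 w).
pose sub (w : flat (par_srt (M := ME) srt)) :
    @term L (W + flat srt) (fun=> tt) tt :=
  match w with
  | existT x k => match x return slot (par_srt srt x) -> _ with
    | inl v => fun k => var1 (inr (existT _ v k))
    | inr m => fun k => var1 (inl (existT _ m k))
    end k
  end.
have subE (c : flat srt -> M tt) :
    projA (fun w => eval (asgU b c) (sub w)) = par_asg (projA c).
  apply: functional_extensionality_dep => -[v//|m].
  exact: (reprK (projT2 m)).
have [||||c cP] := tdef_realise K_reg M_sat (U := flat srt) (J := {p | Sigma p})
    (b := b) (P := fun p d => sat (sval p) (projA (fun w => eval d (sub w)))).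
- exact: small_flat.
- exact: small_sig.
- by move=> p; exact: (tdef_subst sub (hyper_tdef (sval p))).
- move=> l; have [||a aP] := fin [set p | List.In p (List.map sval l)].
  + by apply/finite_set_list; exists (List.map sval l).
  + by move=> _ /List.in_map_iff[p [<- _]]; exact: svalP p.
  exists (fun w => repr (a (projT1 w)) (projT2 w)) => p pl.
  rewrite subE projA_repr; apply: aP.
  by apply/List.in_map_iff; exists p.
- by exists (projA c) => p Sp; rewrite -subE; exact: (cP (exist _ p Sp)).
Qed.

(** * Automorphisms and homogeneity *)

Lemma proj_comp (g : M tt -> M tt) :
  (forall (V : Type) (p : form1 L V) (a : V -> M tt),
     sat p a -> sat p (fun v => g (a v))) ->
  forall s (b c : slot s -> M tt), proj b = proj c ->
  proj (fun k => g (b k)) = proj (fun k => g (c k)).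
Proof.
move=> gP [E|] b c; last by move=> /= ->.
rewrite !proj_eq => bc p Ep; have := gP _ _ _ (bc p Ep).
congr (sat p _); by apply: funext => -[].
Qed.

(** Applying [g] to representatives respects classes because the partial types carry no parameters;
    formulas of [LE] are preserved and reflected since [hyper_tdef] turns them into sets of formulas
    of [L]. *)
Lemma automorphism_lift (g : forall s, M s -> M s) : automorphism g ->
  exists2 G : forall s, ME s -> ME s, automorphism G &
    forall s (b : slot s -> M tt), G s (proj b) = proj (fun k => g tt (b k)).
Proof.
move=> [gbij gpres grefl]; have [g' gK g'K] := gbij tt.
pose lift (k : M tt -> M tt) s (x : ME s) : ME s :=
  proj (fun i => k (repr x i)).
have gproj s b : lift (g tt) s (proj b) = proj (fun k => g tt (b k)).
  by apply: proj_comp (reprK _) => V p a; exact: gpres.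
have g'proj s b : lift g' s (proj b) = proj (fun k => g' (b k)).
  (* The inverse [g'] preserves formulas because [g] reflects them. *)
  apply: proj_comp (reprK _) => V p a pa; apply: grefl.
  congr (sat p _) : pa; by apply: funext => v; rewrite g'K.
have gsat V (srt : V -> sorts LE) (p : form srt) (a : forall v, ME (srt v)) :
    sat p a <-> sat p (fun v => lift (g tt) (srt v) (a v)).
  rewrite -(projA_repr a); set b := fun w => _.
  have -> : (fun v => lift (g tt) (srt v) (projA b v)) =
      projA (fun w => g tt (b w)).
    by apply: functional_extensionality_dep => v; exact: gproj.
  have [S _ SP] := hyper_tdef p; rewrite !SP.
  split=> Sb q /Sb; first exact: gpres.
  exact: grefl.
exists (lift (g tt)) => //; split.
- move=> s; exists (lift g' s) => x; rewrite -(reprK x).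
    by rewrite gproj g'proj; congr proj; apply: funext => k; rewrite gK.
  by rewrite g'proj gproj; congr proj; apply: funext => k; rewrite g'K.
- by move=> V srt p a /gsat.
- by move=> V srt p a ga; apply/gsat.
Qed.

(* The representatives of the images are found by saturation: each finite part
   of the type of [b] amounts to one relation R_phi between the classes. *)
Lemma hyper_transfer (T : theory L) (V : Type) (srt : V -> sorts LE)
    (e' : forall v, ME (srt v)) (b : flat srt -> M tt) :
  existentially_closed T M -> small K [set: V] ->
  (forall p : form srt, sat p (projA b) -> sat p e') ->
  exists2 b' : flat srt -> M tt, projA b' = e' &
    forall p : form1 L (flat srt), sat p b <-> sat p b'.
Proof.
move=> Mec sV bP.
(* Arbitrary representatives of [e'], serving as parameters that fix the classes of the unknown
   tuple. *)
pose b0 (w : flat srt) := repr (e' (projT1 w)) (projT2 w).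
pose P (j : {p : form1 L (flat srt) | sat p b} + V)
    (d : flat srt + flat srt -> M tt) :=
  match j with
  | inl p => sat (sval p) (fun w => d (inr w))
  | inr v => proj (fun k => d (inl (existT _ v k))) =
             proj (fun k => d (inr (existT _ v k)))
  end.
have [||||b' b'P] := tdef_realise K_reg M_sat (b := b0) (P := P).
- exact: small_flat.
- apply: small_sum => //; apply: small_sig.
  have : small K [set: form1 L (flat srt)].
    by apply: small_form; last exact: small_flat.
  exact: small_sub.
- case=> [p|v] /=.
    exact: (tdef_subst (fun w => var1 (inr w)) (tdef_form M K_reg (sval p))).
  pose sub (k : slot (srt v) + slot (srt v)) :
      @term L (flat srt + flat srt) (fun=> tt) tt := match k with
    | inl k => var1 (inl (existT _ v k))
    | inr k => var1 (inr (existT _ v k)) end.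
  exact: (tdef_subst sub (tdef_proj_eq (srt v))).
- move=> l; pose lp := List.flat_map
    (fun j : {p : form1 L (flat srt) | sat p b} + V =>
       match j with inl p => [:: sval p] | inr _ => [::] end) l.
  have [q qP] := hyper_form_repr (Ands lp).
  have /bP/qP[y yE /sat_Ands ly] : sat q (projA b).
    apply/qP; exists b => //; apply/sat_Ands => r /List.in_flat_map.
    by move=> [[p|v] [_ //= [<-|//]]]; exact: (svalP p).
  exists y => -[p|v] jl /=.
    by apply: ly; apply/List.in_flat_map; exists (inl p); split=> //; left.
  by rewrite -[RHS]/(projA y v) yE; exact: (reprK (e' v)).
exists b'.
  apply: functional_extensionality_dep => v.
  by rewrite -(reprK (e' v)); symmetry; exact: (b'P (inr v)).
have bb' p : sat p b -> sat p b'.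
  by move=> pb; exact: (b'P (inl (exist _ p pb))).
move=> p; split=> [|pb']; first exact: bb'.
(* If [p] failed at [b], some [q] true at [b] would contradict it, and [q] passes to [b']. *)
apply: contrapT => /(ec_separation Mec)[q /bb' qb' qP].
exact: qP pb' qb'.
Qed.

(** Equality of coordinates is a formula, so sending [b w] to [b' w] is a well-defined partial map,
    to which homogeneity of [M] applies. *)
Lemma homogeneous_tuple (W : Type) (b b' : W -> M tt) :
  very_homogeneous K M -> small K [set: W] ->
  (forall p : form1 L W, sat p b <-> sat p b') ->
  exists2 g : forall s, M s -> M s, automorphism g &
    forall w, g tt (b w) = b' w.
Proof.
move=> M_hom sW bb'.
pose f (s : sorts L) : M s -> M s := match s with
  | tt => fun x => if pselect (exists w, b w = x) is left H
                   then b' (sval (cid H)) else x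
  end.
have fb w : f tt (b w) = b' w.
  rewrite /f; case: pselect => [H|[]]; last by exists w.
  case: cid => w' /= w'w.
  exact: (iffLR (bb' (Eq (var1 w') (var1 w))) w'w).
pose D := (fun w => existT M tt (b w)) @` setT.
have [||g g_aut gE] := M_hom D f.
- exact: small_image.
- move=> V srt p a.
  have srtE : srt = fun=> tt by apply: funext => v; case: (srt v).
  move: p a; rewrite srtE => p a aD.
  have /choice[r rP] v : exists w, b w = a v.
    by have [w _ wE] := aD v; exists w; exact: existT_snd_inj wE.
  have [q qP] := form_subst (fun v => var1 (r v)) p.
  have aE : a = fun v => b (r v) by apply: funext.
  rewrite aE; have := bb' q; rewrite !qP /= => ->.
  suff -> : (fun v => f tt (b (r v))) = fun v => b' (r v) by [].
  by apply: funext => v; exact: fb.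
exists g => // w; rewrite gE //; by exists w.
Qed.

Lemma hyper_homogeneous (T : theory L) : existentially_closed T M ->
  very_homogeneous K M -> very_homogeneous K ME.
Proof.
move=> Mec M_hom D f sD fP.
(* The domain of [f] serves as the context, so that [f] becomes a correspondence between two
   tuples. *)
pose V := {d | D d}; pose srt (d : V) := projT1 (sval d).
pose e (d : V) : ME (srt d) := projT2 (sval d).
pose b (w : flat srt) := repr (e (projT1 w)) (projT2 w).
have bE : projA b = e := projA_repr e.
have sV : small K [set: V] by exact: small_sig.
have [|b' b'E bb'] := @hyper_transfer T V srt (fun d => f _ (e d)) b Mec sV.
  move=> p; rewrite bE; apply: iffLR; apply: fP => -[[s x] Dx] //.
have [g g_aut gb] := homogeneous_tuple M_hom (small_flat srt sV) bb'.
have [G G_aut GE] := automorphism_lift g_aut; exists G => // s x Dx.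
pose d : V := exist _ (existT _ s x) Dx.
rewrite -[LHS]/(G (srt d) (e d)) -[RHS]/((fun d => f _ (e d)) d) -b'E -bE GE.
by congr proj; apply: funext => k; exact: gb.
Qed.

End Translation.

Theorem theorem10p15 (L : signature1) (T : theory L) (K : Type)
    (M : structure L) (EE : ptype_family L)
    (K_reg : uncountable_regular K)
    (L_small : small_signature K L)
    (T_jep : joint_embedding T)
    (M_monster : monster K T M)
    (EE_small : forall E : EE, small K [set: ptlen E])
    (EE_equiv : defines_equivalences EE M) :
  monster K (hyper_theory EE M) (hyper_struct EE M).
Proof.
have [Mec M_sat M_hom] := M_monster; split.
- exact: (hyper_existentially_closed K_reg L_small M_sat EE_small EE_equiv Mec).
- exact: (hyper_saturated K_reg L_small M_sat EE_small EE_equiv).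
- exact: (hyper_homogeneous K_reg L_small M_sat EE_small EE_equiv Mec M_hom).
Qed.
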